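(* Let $K$ be a field, $d,n\ge 1$. Every ideal $I\subseteq K[X]$ corresponding to a point of the multigraded Hilbert scheme $H_{d,n}$ is a radical ideal.
   Context: Let $X=(x_{ij})$ be a $d\times n$ matrix of indeterminates and $K[X]$ the polynomial ring in these $dn$ variables, $\mathbb{Z}^n$-graded by column degree: $\deg(x_{ij})=e_j$ (the $j$-th standard basis vector). The multigraded Hilbert scheme $H_{d,n}$ parametrizes all $\mathbb{Z}^n$-homogeneous ideals $I\subseteq K[X]$ such that for every $u=(u_1,\dots,u_n)\in\mathbb{N}^n$, $\dim_K (K[X]/I)_u=\binom{u_1+\cdots+u_n+d-1}{d-1}$. (The ideal $I_2(X)$ of $2\times 2$ minors of $X$ is such an ideal.) *)

(* Defs.v *)
From HB Require Import structures.
From mathcomp Require Import all_boot all_order all_algebra.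
From mathcomp Require Import finmap mpoly.
Set Implicit Arguments. Unset Strict Implicit. Unset Printing Implicit Defensive.
Import GRing.Theory.
Local Open Scope ring_scope.

(* K[X] with X = (x_ij) a d x n matrix of indeterminates is modelled as
   {mpoly K[d * n]}; the variable x_ij is 'X_(mxvec_index i j). *)

(* column degree of a monomial: its Z^n-degree, deg x_ij = e_j *)
Definition coldeg (d n : nat) (m : 'X_{1..d * n}) (j : 'I_n) : nat :=
  (\sum_(i < d) m (mxvec_index i j))%N.

Definition is_homog_of (K : fieldType) (d n : nat) (u : 'I_n -> nat)
    (f : {mpoly K[d * n]}) : Prop :=
  forall m, m \in msupp f -> forall j, coldeg m j = u j.

Definition homog_comp (K : fieldType) (d n : nat) (u : 'I_n -> nat)
    (f : {mpoly K[d * n]}) : {mpoly K[d * n]} :=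
  \sum_(m <- msupp f | [forall j, coldeg m j == u j]) f@_m *: 'X_[m].

Definition is_ideal (R : comNzRingType) (I : R -> Prop) : Prop :=
  [/\ I 0, (forall f g, I f -> I g -> I (f + g)) &
      (forall f g, I g -> I (f * g))].

(* Z^n-homogeneous ideal: contains all multihomogeneous components of its
   elements (equivalently, generated by multihomogeneous elements) *)
Definition is_multihomog_ideal (K : fieldType) (d n : nat)
    (I : {mpoly K[d * n]} -> Prop) : Prop :=
  is_ideal I /\ forall f u, I f -> I (homog_comp u f).

(* dim_K (K[X]/I)_u = N : there are N elements of K[X]_u whose classes
   modulo I form a K-basis of (K[X]/I)_u = K[X]_u / (I cap K[X]_u). *)
Definition quot_graded_dim (K : fieldType) (d n : nat)
    (I : {mpoly K[d * n]} -> Prop) (u : 'I_n -> nat) (N : nat) : Prop :=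
  exists b : 'I_N -> {mpoly K[d * n]},
    [/\ forall k, is_homog_of u (b k),
        (forall c : 'I_N -> K, I (\sum_(k < N) c k *: b k) -> forall k, c k = 0) &
        (forall f, is_homog_of u f ->
           exists c : 'I_N -> K, I (f - \sum_(k < N) c k *: b k))].

Definition in_Hdn (K : fieldType) (d n : nat)
    (I : {mpoly K[d * n]} -> Prop) : Prop :=
  is_multihomog_ideal I /\
  forall u : 'I_n -> nat,
    quot_graded_dim I u 'C((\sum_(j < n) u j) + d - 1, d - 1).

Definition is_radical (R : comNzRingType) (I : R -> Prop) : Prop :=
  forall f (k : nat), I (f ^+ k) -> I f.

(* Main.v *)
From HB Require Import structures.
Require Import Defs.
From mathcomp Require Import all_boot all_order all_algebra.
From mathcomp Require Import finmap mpoly.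
From mathcomp Require Import zify.
From Stdlib Require Import Classical.
Set Implicit Arguments. Unset Strict Implicit. Unset Printing Implicit Defensive.
Import Order.TTheory GRing.Theory.
Local Open Scope ring_scope.

(* Write C_D(u) for the binomial (|u| + D choose D). The heart is a lower bound:
   if I is multihomogeneous with Hilbert function C_D in all large degrees, and J
   is an ideal with J J contained in I, then K[X]/J has dimension at least C_D(u)
   in every degree u. This goes by induction on D + |u|. Over K(t), take the form
   l = sum_i t^i x_ij in a column j with u_j > 0. By McCoy's argument l is
   regular modulo the saturation I' of I by the x_ij, and I' agrees with I in
   large degrees. Hence (I', J : l) satisfies the hypotheses for D, (I + l, J + l)
   satisfies them for D - 1, and
     dim (K[X]/J)_u >= dim (K[X]/(J : l))_(u - e_j) + dim (K[X]/(J + l))_u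
   gives Pascal's recursion. If now f is homogeneous with f^2 in I, the bound for
   J = I + (f) and D = d - 1 shows J = I in the degree of f, so f is in I. *)

(** * Multidegrees *)

Lemma coldegD d n (m1 m2 : 'X_{1..d * n}) j :
  coldeg (m1 + m2)%MM j = (coldeg m1 j + coldeg m2 j)%N.
Proof. by rewrite /coldeg -big_split; apply: eq_bigr => i _; rewrite mnmDE. Qed.

Lemma coldegU d n (i : 'I_d) (j k : 'I_n) :
  coldeg U_(mxvec_index i j)%MM k = (j == k).
Proof.
have inj (a b : 'I_d) (c e : 'I_n) :
    (mxvec_index a c == mxvec_index b e) = (a == b) && (c == e).
  rewrite /mxvec_index (inj_eq (@cast_ord_inj _ _ _)) (inj_eq enum_rank_inj).
  by rewrite xpair_eqE.
rewrite /coldeg; under eq_bigr => a _ do rewrite mnm1E inj.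
rewrite (bigD1 i) //= eqxx big1 ?addn0 // => a /negPf ai.
by rewrite eq_sym ai.
Qed.

Lemma coldegMU d n (i : 'I_d) (j k : 'I_n) N :
  coldeg (U_(mxvec_index i j) *+ N)%MM k = ((j == k) * N)%N.
Proof.
rewrite -(coldegU i) /coldeg big_distrl /=.
by apply: eq_bigr => a _; rewrite mulmnE.
Qed.

Section Homog.
Variables (K : fieldType) (d n : nat).
Implicit Types (f g p : {mpoly K[d * n]}) (u w : 'I_n -> nat).

Lemma mcoeff_homog_comp u f m :
  (homog_comp u f)@_m = if [forall j, coldeg m j == u j] then f@_m else 0.
Proof.
rewrite /homog_comp raddf_sum /=.
have [mf|mf] := boolP (m \in msupp f); last first.
  rewrite (memN_msupp_eq0 mf) if_same big_seq_cond big1 // => k /andP[kf _].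
  rewrite mcoeffZ mcoeffX; have [km|_] := eqVneq k m; last by rewrite mulr0.
  by rewrite km (negPf mf) in kf.
under eq_bigr => k _ do rewrite mcoeffZ mcoeffX.
rewrite big_mkcond (bigD1_seq m) ?msupp_uniq //= eqxx mulr1 big1 ?addr0 //.
by move=> k /negPf ->; rewrite mulr0 if_same.
Qed.

Lemma homog_compP u f :
  is_homog_of u f <-> (forall m, f@_m != 0 -> forall j, coldeg m j = u j).
Proof. by split=> H m; [rewrite -mcoeff_msupp|rewrite mcoeff_msupp]; apply: H. Qed.

Lemma homog_comp_is_homog u f : is_homog_of u (homog_comp u f).
Proof.
apply/homog_compP => m; rewrite mcoeff_homog_comp.
by case: ifP => [/forallP H _ j|]; rewrite ?eqxx //; apply/eqP.
Qed.

Lemma homog_comp_id u f : is_homog_of u f -> homog_comp u f = f.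
Proof.
move=> /homog_compP H; apply/mpolyP => m; rewrite mcoeff_homog_comp.
case: ifP => // /forallP Hn; apply/eqP; rewrite eq_sym; apply/negPn/negP => /H Hm.
by apply: Hn => j; rewrite Hm.
Qed.

Lemma homog_comp_linear u : linear (@homog_comp K d n u).
Proof.
move=> c f g; apply/mpolyP => m.
rewrite mcoeffD mcoeffZ !mcoeff_homog_comp mcoeffD mcoeffZ.
by case: ifP; rewrite ?mulr0 ?addr0.
Qed.

HB.instance Definition _ u :=
  GRing.isLinear.Build K {mpoly K[d * n]} {mpoly K[d * n]} _ (homog_comp u)
    (homog_comp_linear u).

Lemma is_homog_of_eq u w f : u =1 w -> is_homog_of u f -> is_homog_of w f.
Proof. by move=> e H m /H h j; rewrite h e. Qed.

Lemma eq_homog_comp u w f : u =1 w -> homog_comp u f = homog_comp w f.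
Proof.
move=> e; apply/mpolyP => m; rewrite !mcoeff_homog_comp.
by under eq_forallb => j do rewrite e.
Qed.

Lemma is_homog_of0 u : is_homog_of u (0 : {mpoly K[d * n]}).
Proof. by move=> m; rewrite mcoeff_msupp mcoeff0 eqxx. Qed.

Lemma is_homog_of_lin u c f g :
  is_homog_of u f -> is_homog_of u g -> is_homog_of u (c *: f + g).
Proof.
move=> /homog_comp_id <- /homog_comp_id <-; rewrite -linearP.
exact: homog_comp_is_homog.
Qed.

Lemma is_homog_ofD u f g :
  is_homog_of u f -> is_homog_of u g -> is_homog_of u (f + g).
Proof. by move=> uf ug; rewrite -[f]scale1r; exact: is_homog_of_lin. Qed.

Lemma is_homog_ofZ u c f : is_homog_of u f -> is_homog_of u (c *: f).
Proof.
move=> uf; rewrite -[_ *: _]addr0.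
by apply: is_homog_of_lin => //; apply: is_homog_of0.
Qed.

Lemma is_homog_of_sum u (T : Type) (r : seq T) (P : pred T)
    (F : T -> {mpoly K[d * n]}) :
  (forall i, P i -> is_homog_of u (F i)) ->
  is_homog_of u (\sum_(i <- r | P i) F i).
Proof.
by move=> H; elim/big_ind: _ => //; [exact: is_homog_of0|exact: is_homog_ofD].
Qed.

Lemma is_homog_ofX u m : (forall j, coldeg m j = u j) ->
  is_homog_of u ('X_[m] : {mpoly K[d * n]}).
Proof. by move=> H k; rewrite msuppX inE => /eqP ->. Qed.

Lemma msuppM p f m : m \in msupp (p * f) ->
  exists m1 m2, [/\ m1 \in msupp p, m2 \in msupp f & m = (m1 + m2)%MM].
Proof. by move=> /msuppM_le/allpairsP[[a b] /= [? ? ?]]; exists a, b. Qed.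

Lemma is_homog_ofM u w f g : is_homog_of u f -> is_homog_of w g ->
  is_homog_of (fun j => u j + w j)%N (f * g).
Proof. by move=> H1 H2 m /msuppM[a [b [/H1 ha /H2 hb ->]]] j; rewrite coldegD ha hb. Qed.

Lemma homog_comp_eq0 u f :
  (forall m, m \in msupp f -> ~ (forall j, coldeg m j = u j)) -> homog_comp u f = 0.
Proof.
move=> H; apply/mpolyP => m; rewrite mcoeff_homog_comp mcoeff0.
case: ifP => // /forallP e; apply/eqP; rewrite mcoeff_eq0; apply/negP => /H.
by apply=> j; apply/eqP.
Qed.

Lemma homog_compM w u p f : is_homog_of w p -> (forall j, w j <= u j)%N ->
  homog_comp u (p * f) = p * homog_comp (fun j => u j - w j)%N f.
Proof.
move=> Hp le_wu; set v := fun j => (u j - w j)%N.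
have -> : p * f = p * homog_comp v f + p * (f - homog_comp v f).
  by rewrite -mulrDr addrC subrK.
rewrite raddfD /= (@homog_comp_id u (p * homog_comp v f)); last first.
  have := @is_homog_ofM _ _ _ _ Hp (homog_comp_is_homog (u := v) (f := f)).
  by apply: is_homog_of_eq => j; rewrite /v subnKC.
(* A term of degree [u] in [p * (f - homog_comp v f)] would need a factor of degree [v = u - w] from
   the remainder, which has none. *)
rewrite [X in _ + X]homog_comp_eq0 ?addr0 // => m /msuppM[a [b [/Hp ha hb ->]]] e.
have eb j : coldeg b j = v j by rewrite /v -e coldegD ha addKn.
move: hb; rewrite mcoeff_msupp mcoeffB mcoeff_homog_comp.
have -> : [forall j, coldeg b j == v j] by apply/forallP => j; rewrite eb.
by rewrite subrr eqxx.
Qed.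

Lemma homog_compM_eq0 w u p f j : is_homog_of w p -> (u j < w j)%N ->
  homog_comp u (p * f) = 0.
Proof.
move=> Hp lt_uw; apply: homog_comp_eq0 => m /msuppM[a [b [/Hp ha _ ->]]] /(_ j) e.
by move: lt_uw; rewrite -e coldegD ha ltnNge leq_addr.
Qed.

End Homog.

(** * Closure properties of ideals *)

Section Ideals.
Variables (R : comNzRingType) (I : R -> Prop).
Hypothesis idI : is_ideal I.

Lemma is_ideal0 : I 0. Proof. by case: idI. Qed.
Lemma is_idealD f g : I f -> I g -> I (f + g).
Proof. by case: idI => _ H _; apply: H. Qed.
Lemma is_idealMr f g : I g -> I (f * g). Proof. by case: idI => _ _; apply. Qed.
Lemma is_idealMl f g : I f -> I (f * g). Proof. by rewrite mulrC; apply: is_idealMr. Qed.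
Lemma is_idealN f : I f -> I (- f). Proof. by rewrite -mulN1r; apply: is_idealMr. Qed.
Lemma is_idealB f g : I f -> I g -> I (f - g).
Proof. by move=> If /is_idealN; apply: is_idealD. Qed.
Lemma is_ideal_sum (T : Type) (r : seq T) (P : pred T) F :
  (forall i, P i -> I (F i)) -> I (\sum_(i <- r | P i) F i).
Proof. by move=> H; elim/big_ind: _ => //; [exact: is_ideal0|exact: is_idealD]. Qed.
Lemma is_ideal_subr f g : I (f - g) -> I g -> I f.
Proof. by move=> H1 H2; rewrite -(subrK g f); apply: is_idealD. Qed.
End Ideals.

Lemma is_idealZ (K : fieldType) k (I : {mpoly K[k]} -> Prop) c f :
  is_ideal I -> I f -> I (c *: f).
Proof. by move=> idI If; rewrite -mul_mpolyC; apply: is_idealMr. Qed.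

(** * Saturation by a column *)

(** Turns finitely many existential bounds, on exponents or degrees, into a single one; monotonicity
    lets the maximum serve for all. *)
Lemma seq_uniform_bound (T : eqType) (s : seq T) (Q : T -> nat -> Prop) :
  (forall b M N, (M <= N)%N -> Q b M -> Q b N) ->
  (forall b, b \in s -> exists N, Q b N) ->
  exists N, forall b, b \in s -> Q b N.
Proof.
move=> mono; elim: s => [|a s IH] H; first by exists 0%N.
have [|N HN] := IH; first by move=> b bs; apply: H; rewrite inE bs orbT.
have [|M HM] := H a; first by rewrite inE eqxx.
exists (maxn M N) => b; rewrite inE => /orP[/eqP->|/HN].
  exact: mono (leq_maxl _ _) HM.
exact: mono (leq_maxr _ _).
Qed.

Lemma dickson k (P : 'X_{1..k} -> Prop) :
  exists s : seq 'X_{1..k}, (forall a, a \in s -> P a) /\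
    forall a, P a -> exists2 b, b \in s & (b <= a)%MM.
Proof.
(* Induction on the number c of coordinates in which divisibility is required. *)
suff H c : (c <= k)%N -> forall Q : 'X_{1..k} -> Prop, exists s : seq 'X_{1..k},
    (forall a, a \in s -> Q a) /\
    forall a, Q a -> exists2 b, b \in s & forall i : 'I_k, (i < c)%N -> (b i <= a i)%N.
  have [s [sP Ps]] := H k (leqnn k) P; exists s; split=> // a /Ps[b bs ba].
  by exists b => //; apply/mnm_lepP => i; apply: ba.
elim: c => [_ Q|c IH lt_ck Q].
  have [[a Qa]|nQ] := classic (exists a, Q a).
    exists [:: a]; split=> [b|b _]; first by rewrite inE => /eqP ->.
    by exists a; rewrite ?inE.
  by exists [::]; split=> // a Qa; case: nQ; exists a.
pose i0 := Ordinal lt_ck.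
have [s [sQ Qs]] := IH (ltnW lt_ck) Q.
have [K HK] : exists K, forall b, b \in s -> (b i0 <= K)%N.
  apply: (@seq_uniform_bound _ s (fun (b : 'X_{1..k}) K => b i0 <= K)%N).
    move=> b M N MN bM; exact: leq_trans bM MN.
  by move=> b _; exists (b i0).
(* An [a] with [K <= a i0] is already handled by [s]. Below [K] the new coordinate takes finitely
   many values, and on each slice it is constant, so the induction hypothesis suffices. *)
have [r [rQ Qr]] : exists r : seq 'X_{1..k}, (forall a, a \in r -> Q a) /\
    forall a, Q a -> (a i0 < K)%N ->
      exists2 b, b \in r & forall i : 'I_k, (i < c.+1)%N -> (b i <= a i)%N.
  elim: K {HK} => [|K [r [rQ Qr]]]; first by exists [::].
  have [t [tQ Qt]] := IH (ltnW lt_ck) (fun a => Q a /\ a i0 = K).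
  exists (r ++ t); split=> [a|a Qa].
    by rewrite mem_cat => /orP[/rQ|/tQ[]].
  rewrite ltnS leq_eqVlt => /orP[/eqP aK|/(Qr a Qa)[b br ba]]; last first.
    by exists b => //; rewrite mem_cat br.
  have [b bt ba] := Qt a (conj Qa aK); exists b; first by rewrite mem_cat bt orbT.
  move=> i; rewrite ltnS leq_eqVlt => /orP[/eqP ic|/ba//].
  have -> : i = i0 by apply/val_inj.
  by have [_ ->] := tQ b bt; rewrite aK.
exists (s ++ r); split=> [a|a Qa].
  by rewrite mem_cat => /orP[/sQ|/rQ].
have [aK|Ka] := ltnP (a i0) K.
  by have [b br ba] := Qr a Qa aK; exists b => //; rewrite mem_cat br orbT.
have [b bs ba] := Qs a Qa; exists b; first by rewrite mem_cat bs.
move=> i; rewrite ltnS leq_eqVlt => /orP[/eqP ic|/ba//].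
have -> : i = i0 by apply/val_inj.
exact: leq_trans (HK b bs) Ka.
Qed.

Section Saturation.
Variables (K : fieldType) (d n : nat).
Implicit Types (I : {mpoly K[d * n]} -> Prop) (f g : {mpoly K[d * n]}).

(** The saturation of I by the ideal of all variables of column j. Since the column is finite, it is
    enough to ask for powers of the single variables, with one exponent for all of them. *)
Definition sat (j : 'I_n) I f : Prop :=
  exists N, forall i : 'I_d, I ('X_(mxvec_index i j) ^+ N * f).

Lemma is_ideal_expMr I N M (x f : {mpoly K[d * n]}) : is_ideal I ->
  (N <= M)%N -> I (x ^+ N * f) -> I (x ^+ M * f).
Proof.
by move=> idI NM H; rewrite -(subnK NM) exprD -mulrA; apply: is_idealMr.
Qed.

Lemma sub_sat j I f : is_ideal I -> I f -> sat j I f.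
Proof. by move=> idI If; exists 0%N => i; apply: is_idealMr. Qed.

Lemma sat_ideal j I : is_ideal I -> is_ideal (sat j I).
Proof.
move=> idI; split; first exact: sub_sat (is_ideal0 idI).
  move=> f g [M HM] [N HN]; exists (maxn M N) => i; rewrite mulrDr.
  by apply: is_idealD => //; [move: (HM i)|move: (HN i)]; apply: is_ideal_expMr;
    rewrite ?leq_maxl ?leq_maxr.
by move=> f g [N HN]; exists N => i; rewrite mulrCA; apply: is_idealMr.
Qed.

Lemma is_homog_X (i : 'I_d) j N :
  is_homog_of (fun k => (j == k) * N)%N ('X_(mxvec_index i j) ^+ N : {mpoly K[d * n]}).
Proof. by rewrite mpolyXn; apply: is_homog_ofX => k; rewrite coldegMU. Qed.

Lemma sat_homog j I : is_multihomog_ideal I -> is_multihomog_ideal (sat j I).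
Proof.
move=> [idI hI]; split; first exact: sat_ideal.
move=> f u [N HN]; exists N => i.
have := hI _ (fun k => u k + (j == k) * N)%N (HN i).
rewrite (homog_compM _ (@is_homog_X i j N)); last by move=> k; rewrite leq_addl.
by congr I; congr (_ * _); apply: eq_homog_comp => k; rewrite addnK.
Qed.

Lemma sat_coldeg j I g : is_ideal I -> sat j I g ->
  exists N, forall m, (N < coldeg m j)%N -> I ('X_[m] * g).
Proof.
move=> idI [N HN]; exists (d * N)%N => m lt_m.
(* Pigeonhole: if all d exponents in column j were below N, their sum could not exceed d N. *)
have [i Ni] : exists i : 'I_d, (N <= m (mxvec_index i j))%N.
  apply/existsP; move: lt_m; apply: contraTT; rewrite negb_exists -leqNgt.
  move=> /forallP H; 
  have -> : (d * N = \sum_(i < d) N)%N by rewrite sum_nat_const card_ord.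
  by apply: leq_sum => i _; rewrite ltnW // ltnNge.
have le_m : (U_(mxvec_index i j) *+ N <= m)%MM.
  apply/mnm_lepP => k; rewrite mulmnE mnm1E.
  by case: eqP => [<-|_]; rewrite ?mul1n ?mul0n.
rewrite -(submK le_m) mpolyXD -mulrA -mpolyXn.
exact: is_idealMr.
Qed.

(** A Gröbner basis argument. By Dickson, finitely many homogeneous g in the saturation have leading
    monomials dividing all others. By [sat_coldeg], each g falls into I once multiplied by a
    monomial of large degree in column j, and in large degree every reduction step uses such a
    multiple. *)
Lemma sat_eventually j I : is_ideal I -> exists B, forall u f,
  is_homog_of u f -> (B <= u j)%N -> sat j I f -> I f.
Proof.
move=> idI.
pose lead b g := [/\ g != 0, is_homog_of (coldeg b) g & mlead g = b].
have [s [sL Ls]] := dickson (fun b => exists2 g, sat j I g & lead b g).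
have [N HN] : exists N, forall b, b \in s -> (coldeg b j <= N)%N /\ exists2 g,
    lead b g & forall m, (N < coldeg m j)%N -> sat j I g /\ I ('X_[m] * g).
  apply: seq_uniform_bound => [b M N MN [bM [g gl HM]]|b /sL[g sg gl]].
    split; first exact: leq_trans MN.
    by exists g => // m /(leq_ltn_trans MN); apply: HM.
  have [N HN] := sat_coldeg idI sg; exists (maxn N (coldeg b j)).
  rewrite leq_maxr; split=> //; exists g => // m; rewrite gtn_max => /andP[Nm _].
  by split=> //; apply: HN.
(* One [N] bounds the column degree of the divisor [b]; the rest forces the cofactor [m] to have
   column degree above [N]. *)
exists (N + N).+1 => u f uf Bu.
elim/mleadrect: f uf => f IH uf sf.
have [->|nf] := eqVneq f 0; first exact: is_ideal0.
have uE : coldeg (mlead f) =1 u by move=> k; apply: uf; apply: mlead_supp.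
have /Ls[b bs bf] : exists2 g, sat j I g & lead (mlead f) g.
  by exists f => //; split=> //; apply: is_homog_of_eq uf => k.
have [bN [g [ng bg gb] Hg]] := HN b bs.
pose m := (mlead f - b)%MM.
have mbE : (m + b)%MM = mlead f by rewrite submK.
have Nm : (N < coldeg m j)%N.
  by rewrite -(ltn_add2r (coldeg b j)) -coldegD mbE uE (leq_trans _ Bu) // ltnS leq_add2l.
have [sg Img] := Hg m Nm.
have lmg : mlead ('X_[m] * g) = mlead f.
  by rewrite mleadM // ?mleadXm ?gb // -msupp_eq0 msuppX.
have nmg : 'X_[m] * g != 0.
  by rewrite mulf_neq0 // -msupp_eq0 msuppX.
pose c := f@_(mlead f) / ('X_[m] * g)@_(mlead f).
apply: (is_ideal_subr idI (g := c *: ('X_[m] * g))); last exact: is_idealZ.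
have Dh : is_homog_of u (f - c *: ('X_[m] * g)).
  apply: is_homog_ofD => //; rewrite -scaleNr; apply: is_homog_ofZ.
  apply: is_homog_of_eq (is_homog_ofM (u := coldeg m) _ bg) => [k|].
    by rewrite -coldegD mbE uE.
  exact: is_homog_ofX.
have [->|nD] := eqVneq (f - c *: ('X_[m] * g)) 0; first exact: is_ideal0.
apply: IH => //; last first.
  have idS := sat_ideal j idI; apply: is_idealB => //; apply: is_idealZ => //.
  exact: is_idealMr.
(* Subtraction cannot raise the leading monomial, and [c] was chosen to cancel its coefficient, so
   it drops strictly. *)
rewrite lt_neqAle; apply/andP; split; last first.
  apply: le_trans (mleadB_le _ _) _; rewrite leUx lexx /= -lmg.
  exact: mleadZ_le.
apply/eqP => e; have := mlead_supp nD; rewrite e mcoeff_msupp mcoeffB mcoeffZ.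
by rewrite divfK ?subrr ?eqxx // -lmg mleadc_eq0.
Qed.

End Saturation.

(** * Base change to K(t) and the generic linear form *)

Section McCoy.
Variable R : comNzRingType.
Implicit Types (I Q : R -> Prop) (lam G : {poly R}).

(** The extended ideal I[t] of R[t]. *)
Definition poly_in I G := forall k, I G`_k.

Lemma poly_in_ideal I : is_ideal I -> is_ideal (poly_in I).
Proof.
move=> idI; split; first by move=> k; rewrite coef0; apply: is_ideal0.
  by move=> F G HF HG k; rewrite coefD; apply: is_idealD.
by move=> F G HG k; rewrite coefM; apply: is_ideal_sum => // i _; apply: is_idealMr.
Qed.

(** McCoy's argument: one coefficient regular modulo Q makes [lam] regular modulo Q[t]. By induction
    on the size of the second factor, every single coefficient of [lam] carries it into Q[t]; the
    regular coefficient then gives the claim. *)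
Lemma mccoy_regular Q lam G k0 : is_ideal Q ->
  (forall x, Q (lam`_k0 * x) -> Q x) -> poly_in Q (lam * G) -> poly_in Q G.
Proof.
move=> idQ reg; have idP := poly_in_ideal idQ.
suff H r (F : {poly R}) : (size F <= r)%N -> poly_in Q (lam * F) ->
    poly_in Q F by apply: H (leqnn _).
elim: r F => [|r IH] F szF lamF.
  by move/size_poly_leq0P: szF => ->; apply: is_ideal0 idP.
(* Descending induction on [k], starting past the top coefficient of [lam], where the coefficient is
   zero. *)
suff H e k : (size lam <= k + e)%N -> poly_in Q (lam`_k *: F).
  move=> j; apply: reg; rewrite -coefZ; apply: (H (size lam)).
  exact: leq_addl.
elim: e k => [|e IHe] k szk.
  by rewrite nth_default ?scale0r; [exact: is_ideal0 idP|rewrite -(addn0 k)].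
(* In the coefficient of degree k + r of [lam * F], terms with a lower coefficient of [lam] vanish
   by the size of [F], and those with a higher one lie in Q by [IHe]. *)
have Qtop : Q (lam`_k * F`_r).
  have := lamF (k + r)%N; rewrite coefM.
  rewrite (bigD1 (inord k)) //= inordK ?ltnS ?leq_addr // addKn.
  rewrite -[X in _ + X]opprK => /(is_ideal_subr idQ); apply; apply: is_idealN => //.
  apply: is_ideal_sum => // i; rewrite -val_eqE /= inordK ?ltnS ?leq_addr // => ik.
  have [lt_ik|le_ki] := ltnP i k.
    by rewrite [F`__]nth_default ?mulr0; [exact: is_ideal0|apply: leq_trans szF _; lia].
  by rewrite -coefZ; apply: IHe; apply: leq_trans szk _; lia.
have cQ x j : Q x -> Q (x%:P`_j).
  by move=> Qx; rewrite coefC; case: ifP => // _; apply: is_ideal0.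
(* Removing the top term, now known to lie in Q[t], leaves a shorter polynomial that [lam] still
   carries into Q[t]. *)
suff PF' : poly_in Q (lam`_k *: F - (lam`_k * F`_r)%:P * 'X^r).
  by apply: (is_ideal_subr idP PF'); apply: (is_idealMl idP) => j; apply: cQ.
apply: IH.
  apply/leq_sizeP => j; rewrite leq_eqVlt => /orP[/eqP <-|lt_rj].
    by rewrite coefB coefZ coefMXn ltnn subnn coefC /= subrr.
  have Fj : F`_j = 0 by rewrite nth_default // (leq_trans szF).
  rewrite coefB coefZ Fj coefMXn ltnNge (ltnW lt_rj) /= coefC.
  by rewrite subn_eq0 leqNgt lt_rj mulr0 subr0.
rewrite mulrBr; apply: (is_idealB idP).
  by rewrite -scalerAr -mul_polyC; apply: (is_idealMr idP).
by rewrite mulrCA; apply: (is_idealMl idP) => j; apply: cQ.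
Qed.

(** Apply [mccoy_regular] to the saturation Q of I by the coefficient of index [k0]: that
    coefficient is regular modulo Q by construction. [G] has finitely many coefficients, so one
    exponent serves for all. *)
Lemma mccoy I lam G k0 : is_ideal I -> poly_in I (lam * G) ->
  exists N, forall j, I (lam`_k0 ^+ N * G`_j).
Proof.
move=> idI lamG.
pose Q x := exists N, I (lam`_k0 ^+ N * x).
have mono N M x : (N <= M)%N -> I (lam`_k0 ^+ N * x) -> I (lam`_k0 ^+ M * x).
  by move=> NM H; rewrite -(subnK NM) exprD -mulrA; apply: is_idealMr.
have idQ : is_ideal Q.
  split; first by exists 0%N; rewrite mulr0; apply: is_ideal0.
    move=> f g [N HN] [M HM]; exists (maxn N M); rewrite mulrDr.
    by apply: is_idealD => //; [apply: mono HN|apply: mono HM];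
      rewrite ?leq_maxl ?leq_maxr.
  by move=> f g [N HN]; exists N; rewrite mulrCA; apply: is_idealMr.
have QG : poly_in Q G.
  apply: (@mccoy_regular Q lam G k0) => // [x [N HN]|j].
    by exists N.+1; rewrite exprSr -mulrA.
  by exists 0%N; rewrite mul1r.
have [N HN] := @seq_uniform_bound _ (iota 0 (size G))
  (fun j N => I (lam`_k0 ^+ N * G`_j)) (fun j N M => @mono N M _) (fun j _ => QG j).
exists N => j; have [lt_j|le_j] := ltnP j (size G).
  by apply: HN; rewrite mem_iota.
by rewrite [G`__]nth_default ?mulr0 //; exact: is_ideal0.
Qed.
End McCoy.

Lemma fracP (R : idomainType) (c : {fraction R}) :
  exists p q : R, q != 0 /\ FracField.tofrac q * c = FracField.tofrac p.
Proof.
elim/quotW: c => x; exists (frac x).1, (frac x).2; split; first exact: denom_ratioP.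
unlock FracField.tofrac; rewrite -[LHS]FracField.pi_mul; apply/eqmodP => /=.
rewrite FracField.equivfE /FracField.mulf !numden_Ratio ?mul1r ?denom_ratioP ?oner_eq0 //.
by rewrite mulr1 mulrC.
Qed.

(** L is K(t). Only injectivity of the map from K[t] and the existence of denominators are
    retained. *)
Lemma rational_functions (K : fieldType) :
  exists (L : fieldType) (tau : {rmorphism {poly K} -> L}), injective tau /\
    forall c, exists p q, q != 0 /\ tau q * c = tau p.
Proof.
exists {fraction {poly K}}, (@FracField.tofrac {poly K}); split; last exact: fracP.
by move=> p q /eqP; rewrite tofrac_eq => /eqP.
Qed.

Section Extension.
Variables (K L : fieldType) (tau : {rmorphism {poly K} -> L}).
Hypothesis tau_inj : injective tau.
Hypothesis tau_frac : forall c, exists p q, q != 0 /\ tau q * c = tau p.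
Variable k : nat.
Local Notation SK := {mpoly K[k]}.
Local Notation SL := {mpoly L[k]}.

Definition emb : SK -> SL := map_mpoly (tau \o polyC).
HB.instance Definition _ := GRing.RMorphism.copy emb emb.

Lemma embX m : emb 'X_[m] = 'X_[m].
Proof. exact: map_mpolyX. Qed.

Lemma embZ c f : emb (c *: f) = tau c%:P *: emb f.
Proof. exact: map_mpolyZ. Qed.

(* The ring map K[X][t] -> K(t)[X]; after clearing denominators it reaches
   every element. *)
Definition theta : {poly SK} -> SL :=
  horner_eval ((tau 'X)%:MP : SL) \o map_poly emb.
HB.instance Definition _ := GRing.RMorphism.copy theta theta.

Lemma thetaC c : theta c%:P = emb c.
Proof. by rewrite /theta /= map_polyC /= /horner_eval hornerC. Qed.

Lemma thetaX : theta 'X = (tau 'X)%:MP.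
Proof. by rewrite /theta /= map_polyX /= /horner_eval hornerX. Qed.

Lemma mcoeff_theta G m : (theta G)@_m = tau (map_poly (mcoeff m) G).
Proof.
elim/poly_ind: G => [|G c IH]; first by rewrite !raddf0.
have -> : map_poly (mcoeff m) (G * 'X + c%:P) =
    map_poly (mcoeff m) G * 'X + (c@_m)%:P.
  apply/polyP => i; rewrite coef_map /= !coefD !coefMX !coefC mcoeffD.
  by rewrite coef_map /=; case: eqP; rewrite ?mcoeff0.
rewrite rmorphD rmorphM /= thetaX thetaC mcoeffD mulrC mcoeffCM IH.
by rewrite /emb mcoeff_map_mpoly rmorphD rmorphM mulrC.
Qed.

Lemma theta_inj : injective theta.
Proof.
apply: raddf_inj => G G0; apply/polyP => i; apply/mpolyP => m.
rewrite coef0 mcoeff0 -[LHS](coef_map (mcoeff m)) /=.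
suff -> : map_poly (mcoeff m) G = 0 by rewrite coef0.
by apply: tau_inj; rewrite rmorph0 -mcoeff_theta G0 mcoeff0.
Qed.

Lemma theta_map_polyC p : theta (map_poly (@mpolyC k K) p) = (tau p)%:MP.
Proof.
apply/mpolyP => m; rewrite mcoeff_theta mcoeffC; have [->|nm] := eqVneq m 0%MM.
  rewrite mulr1; congr (tau _); apply/polyP => i.
  by rewrite !coef_map /= mcoeffC eqxx mulr1.
rewrite mulr0 -[RHS](rmorph0 tau); congr (tau _); apply/polyP => i.
by rewrite !coef_map /= mcoeffC (negPf nm) mulr0 coef0.
Qed.

Lemma theta_scale p G :
  theta (map_poly (@mpolyC k K) p * G) = tau p *: theta G.
Proof. by rewrite rmorphM /= theta_map_polyC mul_mpolyC. Qed.

Lemma theta_clear F : exists p G, p != 0 /\ tau p *: F = theta G.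
Proof.
elim/mpolyind: F => [|c m F _ _ [p [G [np pF]]]].
  by exists 1, 0; rewrite oner_neq0 scaler0 rmorph0.
have [a [q [nq qc]]] := tau_frac c.
exists (p * q), (map_poly (@mpolyC k K) (p * a) * ('X_[m])%:P +
  map_poly (@mpolyC k K) q * G); split; first by rewrite mulf_neq0.
rewrite [RHS]raddfD /= !theta_scale -pF thetaC embX scalerDr !scalerA.
by rewrite -!rmorphM [q * p]mulrC !rmorphM -mulrA qc.
Qed.

Lemma mpoly_scaleMM (a b : L) (F F' : SL) : (a * b) *: (F * F') = (a *: F) * (b *: F').
Proof. by rewrite -scalerAl -scalerAr scalerA. Qed.

(** The ideal generated by I in K(t)[X], described through cleared denominators so that membership
    reduces to I[t]. *)
Definition scalar_ext (I : SK -> Prop) (F : SL) : Prop :=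
  exists p G, [/\ p != 0, poly_in I G & tau p *: F = theta G].

Section ExtIdeal.
Variable I : SK -> Prop.
Hypothesis idI : is_ideal I.

Lemma scalar_ext_poly_in G : poly_in I G -> scalar_ext I (theta G).
Proof. by move=> IG; exists 1, G; rewrite oner_neq0 rmorph1 scale1r. Qed.

(** The extension contracts back to I[t]: the denominator p has a nonzero constant as leading
    coefficient, which is regular modulo I, so [mccoy_regular] cancels p. *)
Lemma scalar_ext_thetaP G : scalar_ext I (theta G) -> poly_in I G.
Proof.
move=> [p [H [np IH]]]; rewrite -theta_scale => /theta_inj pGH.
apply: (@mccoy_regular _ _ (map_poly (@mpolyC k K) p) _ (size p).-1) => //; last first.
  by rewrite pGH.
move=> x; rewrite coef_map /= mul_mpolyC => /(is_idealZ (lead_coef p)^-1 idI).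
by rewrite scalerA mulVf ?scale1r ?lead_coef_eq0.
Qed.

Lemma scalar_ext_ideal : is_ideal (scalar_ext I).
Proof.
have idP := poly_in_ideal idI.
split; first by have := scalar_ext_poly_in (is_ideal0 idP); rewrite raddf0.
  move=> F F' [p [G [np IG pG]]] [q [H [nq IH qH]]].
  exists (p * q), (map_poly (@mpolyC k K) q * G + map_poly (@mpolyC k K) p * H).
  split; first by rewrite mulf_neq0.
    by apply: (is_idealD idP); apply: (is_idealMr idP).
  rewrite [RHS]raddfD /= !theta_scale -pG -qH !scalerA scalerDr.
  by rewrite -!rmorphM /= [q * p]mulrC.
move=> F F' [p [G [np IG pG]]]; have [q [H [nq qH]]] := theta_clear F.
exists (q * p), (H * G); split; first by rewrite mulf_neq0.
  exact: (is_idealMr idP).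
by rewrite [RHS](rmorphM theta) /= -qH -pG rmorphM mpoly_scaleMM.
Qed.

Lemma scalar_ext_emb f : I f -> scalar_ext I (emb f).
Proof.
move=> If; rewrite -thetaC; apply: scalar_ext_poly_in => i.
by rewrite coefC; case: ifP => // _; apply: is_ideal0.
Qed.

End ExtIdeal.

Lemma scalar_ext_mul (I J : SK -> Prop) : is_ideal I ->
  (forall f g, J f -> J g -> I (f * g)) ->
  forall F G, scalar_ext J F -> scalar_ext J G -> scalar_ext I (F * G).
Proof.
move=> idI JJ F F' [p [G [np IG pG]]] [q [H [nq IH qH]]].
exists (p * q), (G * H); split; first by rewrite mulf_neq0.
  by move=> i; rewrite coefM; apply: is_ideal_sum => // j _; apply: JJ.
by rewrite [RHS](rmorphM theta) /= -pG -qH rmorphM mpoly_scaleMM.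
Qed.

End Extension.

Section GenericForm.
Variables (K L : fieldType) (tau : {rmorphism {poly K} -> L}).
Hypothesis tau_inj : injective tau.
Hypothesis tau_frac : forall c, exists p q, q != 0 /\ tau q * c = tau p.
Variables d n : nat.
Local Notation SK := {mpoly K[d * n]}.
Local Notation SL := {mpoly L[d * n]}.

Local Notation emb := (emb tau).
Local Notation theta := (theta tau).
Local Notation scalar_ext := (scalar_ext tau).

Lemma emb_homog u (f : SK) : is_homog_of u f -> is_homog_of u (emb f).
Proof.
move=> /homog_compP uf; apply/homog_compP => m.
rewrite /emb mcoeff_map_mpoly => nz; apply: uf; apply: contraNneq nz => ->.
by rewrite raddf0.
Qed.

Lemma homog_comp_theta u (G : {poly SK}) :
  homog_comp u (theta G) = theta (map_poly (homog_comp u) G).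
Proof.
apply/mpolyP => m; rewrite (mcoeff_homog_comp u (theta G)) (mcoeff_theta tau G).
rewrite (mcoeff_theta tau (map_poly (homog_comp u) G)).
have -> : map_poly (mcoeff m) (map_poly (homog_comp u) G) =
    if [forall j, coldeg m j == u j] then map_poly (mcoeff m) G else 0.
  apply/polyP => i; rewrite !coef_map /= mcoeff_homog_comp.
  by case: ifP => _; rewrite ?coef0 ?coef_map.
by case: ifP => // _; rewrite rmorph0.
Qed.

Lemma scalar_ext_homog (I : SK -> Prop) :
  is_multihomog_ideal I -> is_multihomog_ideal (scalar_ext I).
Proof.
move=> [idI hI]; split; first exact: scalar_ext_ideal.
move=> F u [p [G [np IG pG]]]; exists p, (map_poly (homog_comp u) G); split=> //.
  by move=> i; rewrite coef_map; apply: hI.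
by rewrite -homog_comp_theta -pG linearZ.
Qed.

(** The generic form as a polynomial in t over K[X]: its coefficients are exactly the variables of
    column j, so [mccoy] yields the saturation by that column. *)
Definition generic_poly (j : 'I_n) : {poly SK} :=
  \sum_(i < d) ('X_(mxvec_index i j))%:P * 'X^i.
Definition generic_form (j : 'I_n) : SL := theta (generic_poly j).

Lemma coef_generic_poly j (i : 'I_d) : (generic_poly j)`_i = 'X_(mxvec_index i j).
Proof.
rewrite coef_sum (bigD1 i) //= coefCM coefXn eqxx mulr1 big1 ?addr0 // => h.
by rewrite -val_eqE eq_sym coefCM coefXn => /negPf ->; rewrite mulr0.
Qed.

Lemma generic_form_homog j : is_homog_of (fun k => (j == k) : nat) (generic_form j).
Proof.
rewrite /generic_form /generic_poly raddf_sum /=; apply: is_homog_of_sum => i _.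
rewrite rmorphM rmorphXn /= thetaX thetaC -rmorphXn mulrC /= mul_mpolyC.
apply: is_homog_ofZ; apply: emb_homog; apply: is_homog_ofX => k.
exact: coldegU.
Qed.

(** After clearing denominators the product lies in I[t]; McCoy is applied once for each variable of
    the column. *)
Lemma generic_form_regular (I : SK -> Prop) j (F : SL) : is_ideal I ->
  scalar_ext I (generic_form j * F) -> sat j (scalar_ext I) F.
Proof.
move=> idI IF; have [p [G [np pG]]] := theta_clear tau_frac F.
have IgG : poly_in I (generic_poly j * G).
  apply: (scalar_ext_thetaP tau_inj idI); rewrite rmorphM /= -pG -scalerAr.
  exact: is_idealZ (scalar_ext_ideal tau_frac idI) IF.
have [N HN] : exists N, forall i, i \in enum 'I_d ->
    forall e, I ('X_(mxvec_index i j) ^+ N * G`_e).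
  apply: seq_uniform_bound => [i M N MN H e|i _]; first exact: is_ideal_expMr (H e).
  by rewrite -coef_generic_poly; apply: mccoy.
exists N => i; exists p, (('X_(mxvec_index i j) ^+ N)%:P * G); split=> //.
  by move=> e; rewrite coefCM; apply: HN; rewrite mem_enum.
by rewrite rmorphM /= thetaC -pG scalerAr rmorphXn /= embX.
Qed.

End GenericForm.

(** * Graded dimensions *)

Section LinearCombination.
Variables (K : fieldType) (V : lmodType K).

Definition lincomb N (b : 'I_N -> V) (v : 'rV[K]_N) : V := \sum_k v 0 k *: b k.

Lemma lincomb_linear N (b : 'I_N -> V) : linear (lincomb b).
Proof.
move=> a v w; rewrite /lincomb scaler_sumr -big_split; apply: eq_bigr => k _ /=.
by rewrite !mxE scalerDl scalerA.
Qed.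

HB.instance Definition _ N b :=
  GRing.isLinear.Build K 'rV[K]_N V _ (lincomb b) (@lincomb_linear N b).

Lemma lincomb_mul N M (b : 'I_N -> V) (A : 'M_(M, N)) v :
  lincomb b (v *m A) = lincomb (fun k => lincomb b (row k A)) v.
Proof. by rewrite mulmx_sum_row linear_sum; apply: eq_bigr => k _; rewrite linearZ. Qed.

Lemma lincomb_row N (b : 'I_N -> V) c : lincomb b (\row_k c k) = \sum_k c k *: b k.
Proof. by apply: eq_bigr => k _; rewrite mxE. Qed.

Lemma lincomb_row_mx N M (b : 'I_(N + M) -> V) v w :
  lincomb b (row_mx v w) = lincomb (b \o lshift M) v + lincomb (b \o @rshift N M) w.
Proof.
rewrite /lincomb big_split_ord; congr (_ + _); apply: eq_bigr => k _ /=.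
  by rewrite row_mxEl.
by rewrite row_mxEr.
Qed.

Lemma lincomb1 (b : 'I_1 -> V) v : lincomb b v = v 0 0 *: b 0.
Proof. by rewrite /lincomb big_ord1. Qed.

End LinearCombination.

Lemma lincombM (K : fieldType) k N (b : 'I_N -> {mpoly K[k]}) l v :
  lincomb (fun i => l * b i) v = l * lincomb b v.
Proof. by rewrite /lincomb mulr_sumr; apply: eq_bigr => i _; rewrite scalerAr. Qed.

Section GradedDim.
Variables (K : fieldType) (d n : nat).
Local Notation S := {mpoly K[d * n]}.
Implicit Types (I J : S -> Prop) (u : 'I_n -> nat) (f g l : S).

Definition indep J N (b : 'I_N -> S) := forall v, J (lincomb b v) -> v = 0.
Definition spans J u N (b : 'I_N -> S) :=
  forall f, is_homog_of u f -> exists v, J (f - lincomb b v).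
(** Expresses that the degree u part of K[X]/J has dimension at least N, without presupposing that
    it is finite. *)
Definition has_indep J u N :=
  exists b : 'I_N -> S, (forall k, is_homog_of u (b k)) /\ indep J b.

Lemma quot_graded_dimP I u N : quot_graded_dim I u N <->
  exists b : 'I_N -> S, [/\ forall k, is_homog_of u (b k), indep I b & spans I u b].
Proof.
split=> -[b [hb ib sb]]; exists b; split=> //.
- by move=> v /ib v0; apply/rowP => k; rewrite v0 mxE.
- by move=> f /sb[c]; exists (\row_k c k); rewrite lincomb_row.
- by move=> c; rewrite -lincomb_row => /ib /rowP c0 k; have := c0 k; rewrite !mxE.
- by move=> f /sb[v Iv]; exists (v 0).
Qed.

Lemma lincomb_homog u N (b : 'I_N -> S) v :
  (forall k, is_homog_of u (b k)) -> is_homog_of u (lincomb b v).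
Proof. by move=> hb; apply: is_homog_of_sum => k _; apply: is_homog_ofZ. Qed.

Lemma lincomb_ideal I N (b : 'I_N -> S) v :
  is_ideal I -> (forall k, I (b k)) -> I (lincomb b v).
Proof. by move=> idI Ib; apply: is_ideal_sum => // k _; apply: is_idealZ. Qed.

Lemma lincombB N (b c : 'I_N -> S) v :
  lincomb b v - lincomb c v = lincomb (fun k => b k - c k) v.
Proof. by rewrite /lincomb -sumrB; apply: eq_bigr => k _; rewrite scalerBr. Qed.

Lemma span_matrix I u N M (b : 'I_N -> S) (c : 'I_M -> S) : is_ideal I ->
  spans I u b -> (forall k, is_homog_of u (c k)) ->
  exists A, forall v, I (lincomb c v - lincomb b (v *m A)).
Proof.
move=> idI sb hc.
have [w Hw] := fin_all_exists (fun k => sb _ (hc k)).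
exists (\matrix_k w k) => v; rewrite lincomb_mul lincombB; apply: lincomb_ideal => // k.
by rewrite rowK.
Qed.

Lemma indep_spans_leq I u N M (c : 'I_M -> S) (b : 'I_N -> S) : is_ideal I ->
  (forall k, is_homog_of u (c k)) -> indep I c -> spans I u b -> (M <= N)%N.
Proof.
move=> idI hc ic sb; have [A HA] := span_matrix idI sb hc.
rewrite leqNgt; apply/negP => lt_NM.
(* With more rows than columns the coordinate matrix has a nonzero kernel vector, which is a
   relation modulo I. *)
have /rowV0Pn[v /sub_kermxP vA /negP[]] : kermx A != 0.
  rewrite -mxrank_eq0 mxrank_ker subn_eq0 -ltnNge.
  exact: leq_ltn_trans (rank_leq_col A) lt_NM.
by apply/eqP/ic; have := HA v; rewrite vA linear0 subr0.
Qed.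

Lemma indep_extend I u N (b : 'I_N -> S) f : is_ideal I ->
  (forall k, is_homog_of u (b k)) -> indep I b -> is_homog_of u f ->
  ~ (exists v, I (f - lincomb b v)) -> has_indep I u N.+1.
Proof.
move=> idI hb ib hf nf.
change (has_indep I u (1 + N)).
pose c (i : 'I_(1 + N)) := match split i with inl _ => f | inr k => b k end.
exists c; split=> [i|]; first by rewrite /c; case: split.
move=> v; rewrite -[v]hsubmxK lincomb_row_mx lincomb1 /=.
have -> : c (lshift N 0) = f by rewrite /c (unsplitK (inl _)).
have -> : lincomb (c \o @rshift 1 N) (rsubmx v) = lincomb b (rsubmx v).
  by apply: eq_bigr => k _; rewrite /= /c (unsplitK (inr _)).
set a := lsubmx v 0 0; have [a0|na] := eqVneq a 0.
  rewrite a0 scale0r add0r => /ib ->; rewrite -[RHS]row_mx0; congr row_mx.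
  by apply/rowP => k; rewrite ord1 -/a a0 mxE.
move=> /(is_idealZ a^-1 idI); rewrite scalerDr scalerA mulVf // scale1r => H.
by case: nf; exists (- (a^-1 *: rsubmx v)); rewrite linearN opprK linearZ.
Qed.

(** Greedy choice: an independent family that does not span can be enlarged by any element outside
    its span. *)
Lemma indep_or_spans I u N : is_ideal I ->
  has_indep I u N \/ exists M (b : 'I_M -> S),
    [/\ (M < N)%N, forall k, is_homog_of u (b k) & spans I u b].
Proof.
move=> idI; elim: N => [|N [[b [hb ib]]|[M [b [MN hb sb]]]]].
- left; exists (fun=> 0); split=> [k|v _]; first by exact: is_homog_of0.
  by apply/rowP => -[].
- have [sb|nsb] := classic (spans I u b); first by right; exists N, b.
  left; apply: NNPP => ni; apply: nsb => f hf; apply: NNPP => nf.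
  exact/ni/(indep_extend _ hb ib hf).
- by right; exists M, b; rewrite ltnS ltnW.
Qed.

Definition ideal_colon J l g := J (l * g).
Definition adjoin I l f := exists a g, I a /\ f = a + l * g.

Lemma ideal_colon_ideal J l : is_ideal J -> is_ideal (ideal_colon J l).
Proof.
move=> idJ; rewrite /ideal_colon; split; first by rewrite mulr0; apply: is_ideal0.
  by move=> f g Hf Hg; rewrite mulrDr; apply: is_idealD.
by move=> f g Hg; rewrite mulrCA; apply: is_idealMr.
Qed.

Lemma sub_adjoin I l f : I f -> adjoin I l f.
Proof. by move=> If; exists f, 0; rewrite mulr0 addr0. Qed.

Lemma adjoin_gen I l g : is_ideal I -> adjoin I l (l * g).
Proof. by move=> idI; exists 0, g; rewrite add0r; split=> //; apply: is_ideal0. Qed.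

Lemma adjoin_ideal I l : is_ideal I -> is_ideal (adjoin I l).
Proof.
move=> idI; split; first by apply: sub_adjoin; apply: is_ideal0.
  move=> f f' [a [g [Ia ->]]] [a' [g' [Ia' ->]]]; exists (a + a'), (g + g').
  by rewrite mulrDr addrACA; split=> //; apply: is_idealD.
move=> h f [a [g [Ia ->]]]; exists (h * a), (h * g).
by rewrite mulrDr [h * (l * g)]mulrCA; split=> //; apply: is_idealMr.
Qed.

(** The degree u - e_j; no truncation takes place when [0 < u j]. *)
Definition pred_deg u (j : 'I_n) := fun k => (u k - (j == k))%N.

Lemma homog_comp_linM u j l g : is_homog_of (fun k => (j == k) : nat) l ->
  (0 < u j)%N -> homog_comp u (l * g) = l * homog_comp (pred_deg u j) g.
Proof. by move=> hl uj; apply: homog_compM => // k; case: eqP => // <-. Qed.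

Lemma homog_comp_linM0 u j l g : is_homog_of (fun k => (j == k) : nat) l ->
  u j = 0%N -> homog_comp u (l * g) = 0.
Proof.
by move=> hl uj; apply: (@homog_compM_eq0 _ _ _ _ _ _ _ j hl); rewrite uj eqxx.
Qed.

Lemma homog_linM u j l g : is_homog_of (fun k => (j == k) : nat) l ->
  (0 < u j)%N -> is_homog_of (pred_deg u j) g -> is_homog_of u (l * g).
Proof.
move=> hl uj hg; apply: is_homog_of_eq (is_homog_ofM hl hg) => k.
by rewrite /pred_deg; case: eqP => [<-|_]; [rewrite subnKC|rewrite subn0].
Qed.

Lemma adjoin_homog I l j : is_homog_of (fun k => (j == k) : nat) l ->
  is_multihomog_ideal I -> is_multihomog_ideal (adjoin I l).
Proof.
move=> hl [idI hI]; split; first exact: adjoin_ideal.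
move=> f u [a [g [Ia ->]]]; rewrite raddfD /=.
have [u0|u0] := posnP (u j).
  by rewrite (homog_comp_linM0 _ hl) // addr0; apply/sub_adjoin/hI.
rewrite (homog_comp_linM _ hl) //.
by apply: (is_idealD (adjoin_ideal l idI)); [apply/sub_adjoin/hI|apply: adjoin_gen].
Qed.

(** Multiplication by l embeds (K[X]/I) in degree u - e_j into degree u, with cokernel K[X]/(I + l).
    [A] is its matrix in the two bases, and a complement of the row space of [A] gives a basis of
    the cokernel. *)
Lemma quot_graded_dim_adjoin I l j u N1 N2 : is_multihomog_ideal I ->
  is_homog_of (fun k => (j == k) : nat) l -> (0 < u j)%N ->
  (forall g, is_homog_of (pred_deg u j) g -> I (l * g) -> I g) ->
  quot_graded_dim I u N1 -> quot_graded_dim I (pred_deg u j) N2 ->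
  quot_graded_dim (adjoin I l) u (N1 - N2).
Proof.
move=> [idI hI] hl uj reg /quot_graded_dimP[b [hb ib sb]].
move=> /quot_graded_dimP[b' [hb' ib' sb']].
have idP := adjoin_ideal l idI.
have [A HA] := span_matrix idI sb (fun k => homog_linM hl uj (hb' k)).
(* Regularity of l: a row killed by [A] is a combination of [b'] that l sends into I. *)
have rA : \rank A = N2.
  apply/eqP; rewrite -/(row_free A) -kermx_eq0; apply/eqP/row_matrixP => i.
  rewrite row0; apply: ib'; apply: reg; first exact: lincomb_homog.
  rewrite -lincombM; have := HA (row i (kermx A)).
  by rewrite -row_mul mulmx_ker row0 linear0 subr0.
rewrite -rA -mxrank_compl; apply/quot_graded_dimP.
set C := row_base (A^C)%MS.
exists (fun k => lincomb b (row k C)); split.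
- by move=> k; apply: lincomb_homog.
- move=> v [a [g [Ia]]]; rewrite -lincomb_mul => /(congr1 (homog_comp u)).
  rewrite raddfD /= (homog_comp_linM _ hl) // homog_comp_id; last exact: lincomb_homog.
  set g' := homog_comp _ g => E.
  have [w Hw] := sb' g' (@homog_comp_is_homog _ _ _ (pred_deg u j) g).
  (* Independence of [b] modulo I turns the relation into an equality of coordinates, so [v *m C]
     lies both in the row space of [A] and in its complement. *)
  have vw : v *m C - w *m A = 0.
    apply: ib; rewrite linearB /= E.
    have -> : homog_comp u a + l * g' - lincomb b (w *m A) = homog_comp u a +
       (l * (g' - lincomb b' w) + (lincomb (fun k => l * b' k) w - lincomb b (w *m A))).
      by rewrite lincombM mulrBr subrKA addrA.
    apply: (is_idealD idI); first exact: hI.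
    by apply: (is_idealD idI) => //; apply: (is_idealMr idI).
  have : (v *m C <= A :&: A^C)%MS.
    rewrite sub_capmx -{1}[v *m C](subrK (w *m A)) vw add0r submxMl /=.
    by rewrite (submx_trans (submxMl _ _)) // eq_row_base.
  rewrite capmx_compl submx0 => /eqP vC.
  by apply: (row_free_inj (row_base_free (A^C)%MS)); rewrite vC mul0mx.
move=> f hf; have [v Hv] := sb f hf.
have /sub_addsmxP[[x y] /= vE] : (v <= A + A^C)%MS.
  by apply: submx_full; apply: addsmx_compl_full.
have /submxP[z yz] : (y *m A^C <= C)%MS by rewrite eq_row_base submxMl.
exists z; rewrite -lincomb_mul -yz.
have -> : f - lincomb b (y *m (A^C)%MS) = (f - lincomb b v) -
    (lincomb (fun k => l * b' k) x - lincomb b (x *m A)) + l * lincomb b' x.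
  by rewrite vE linearD /= lincombM opprB -addrA subrK opprD addrA addrAC subrK.
apply: (is_idealD idP); last exact: adjoin_gen.
by apply: sub_adjoin; apply: is_idealB.
Qed.

(** Join l times the first family with the second. A relation modulo J, read modulo J + l, kills the
    second block of coefficients; what remains is l times a combination of [b], so independence
    modulo J : l kills the first. *)
Lemma has_indep_add J l j u N M : is_ideal J ->
  is_homog_of (fun k => (j == k) : nat) l -> (0 < u j)%N ->
  has_indep (ideal_colon J l) (pred_deg u j) N -> has_indep (adjoin J l) u M ->
  has_indep J u (N + M).
Proof.
move=> idJ hl uj [b [hb ib]] [c [hc ic]].
pose e (i : 'I_(N + M)) := match split i with inl k => l * b k | inr k => c k end.
exists e; split=> [i|v].
  by rewrite /e; case: split => k //; apply: homog_linM (hb k).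
rewrite -[v]hsubmxK lincomb_row_mx.
have -> : lincomb (e \o lshift M) (lsubmx v) = l * lincomb b (lsubmx v).
  by rewrite -lincombM; apply: eq_bigr => k _; rewrite /= /e (unsplitK (inl _)).
have -> : lincomb (e \o @rshift N M) (rsubmx v) = lincomb c (rsubmx v).
  by apply: eq_bigr => k _; rewrite /= /e (unsplitK (inr _)).
move=> Jv; have r0 : rsubmx v = 0.
  apply: ic; exists (l * lincomb b (lsubmx v) + lincomb c (rsubmx v)),
    (- lincomb b (lsubmx v)).
  by split=> //; rewrite mulrN addrAC subrr add0r.
move: Jv; rewrite r0 linear0 addr0 => /ib ->.
exact: row_mx0.
Qed.

End GradedDim.

(** * Graded dimensions under base change *)

Section ExtensionDim.
Variables (K L : fieldType) (tau : {rmorphism {poly K} -> L}).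
Hypothesis tau_inj : injective tau.
Hypothesis tau_frac : forall c, exists p q, q != 0 /\ tau q * c = tau p.
Variables d n : nat.
Local Notation SK := {mpoly K[d * n]}.
Local Notation SL := {mpoly L[d * n]}.
Local Notation emb := (@emb K L tau (d * n)).
Local Notation scalar_ext := (scalar_ext tau).
Implicit Types (I J : SK -> Prop) (u : 'I_n -> nat).

Lemma emb_lincomb N (b : 'I_N -> SK) v :
  emb (lincomb b v) = lincomb (emb \o b) (map_mx (tau \o polyC) v).
Proof.
rewrite /lincomb raddf_sum; apply: eq_bigr => k _ /=.
by rewrite embZ mxE.
Qed.

(** Forms over K(t) are combinations of monomials, and these already come from K[X]. *)
Lemma scalar_ext_spans I u N (b : 'I_N -> SK) : is_ideal I ->
  spans I u b -> spans (scalar_ext I) u (emb \o b).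
Proof.
move=> idI sb F hF; have idE := scalar_ext_ideal tau_frac idI.
rewrite (mpolyE F) big_seq; elim/big_ind: _ => [|G H [v Hv] [w Hw]|m /hF mu].
- by exists 0; rewrite linear0 subr0; apply: (is_ideal0 idE).
- by exists (v + w); rewrite linearD opprD addrACA; apply: (is_idealD idE).
have [v Hv] := sb _ (is_homog_ofX mu).
exists (F@_m *: map_mx (tau \o polyC) v).
rewrite linearZ -scalerBr; apply: (is_idealZ _ idE).
have := scalar_ext_emb tau idI Hv.
by rewrite raddfB /= emb_lincomb embX.
Qed.

Lemma common_denominator N (v : 'I_N -> L) :
  exists q r, q != 0 /\ forall k, tau q * v k = tau (r k).
Proof.
have [p Hp] := fin_all_exists (fun k => tau_frac (v k)).
have [q Hq] := fin_all_exists Hp.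
exists (\prod_k q k), (fun k => p k * \prod_(i | i != k) q i); split.
  by apply/prodf_neq0 => k _; case: (Hq k).
move=> k; rewrite (bigD1 k) //= !rmorphM /= mulrAC; case: (Hq k) => _ ->.
by [].
Qed.

(** A relation over K(t), cleared of denominators, lies in I[t]; each power of t then gives a
    relation over K. *)
Lemma scalar_ext_indep I N (b : 'I_N -> SK) : is_ideal I ->
  indep I b -> indep (scalar_ext I) (emb \o b).
Proof.
move=> idI ib v Ev; have idE := scalar_ext_ideal tau_frac idI.
have [q [r [nq Hr]]] := common_denominator (v 0).
pose G : {poly SK} := \sum_k map_poly (@mpolyC (d * n) K) (r k) * (b k)%:P.
have thG : theta tau G = tau q *: lincomb (emb \o b) v.
  rewrite /G raddf_sum /lincomb scaler_sumr; apply: eq_bigr => k _.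
  by rewrite /= theta_scale thetaC scalerA Hr.
have /(scalar_ext_thetaP tau_inj idI) IG : scalar_ext I (theta tau G).
  by rewrite thG; apply: (is_idealZ _ idE).
have r0 k : r k = 0.
  apply/polyP => i; have := IG i; rewrite coef_sum.
  have -> : \sum_k (map_poly (@mpolyC (d * n) K) (r k) * (b k)%:P)`_i =
      lincomb b (\row_k (r k)`_i).
    by rewrite lincomb_row; apply: eq_bigr => h _; rewrite coefMC coef_map /= mul_mpolyC.
  by move=> /ib /rowP /(_ k); rewrite !mxE coef0.
apply/rowP => k; rewrite mxE; have := Hr k; rewrite r0 rmorph0 => /eqP.
by rewrite mulf_eq0 (raddf_eq0 _ tau_inj) (negPf nq) => /eqP.
Qed.

Lemma scalar_ext_quot_graded_dim I u N : is_ideal I ->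
  quot_graded_dim I u N -> quot_graded_dim (scalar_ext I) u N.
Proof.
move=> idI /quot_graded_dimP[b [hb ib sb]]; apply/quot_graded_dimP.
exists (emb \o b); split; [|exact: scalar_ext_indep|exact: scalar_ext_spans].
by move=> k; apply: emb_homog.
Qed.

(** Otherwise fewer than N elements span over K, hence also over K(t), against the N independent
    ones there. *)
Lemma has_indep_descent J u N : is_ideal J ->
  has_indep (scalar_ext J) u N -> has_indep J u N.
Proof.
move=> idJ [c [hc ic]].
have [//|[M [b [lt_MN hb sb]]]] := indep_or_spans u N idJ.
have := indep_spans_leq (scalar_ext_ideal tau_frac idJ) hc ic (scalar_ext_spans idJ sb).
by rewrite leqNgt lt_MN.
Qed.

Lemma sat_idem (I : SL -> Prop) j F : is_ideal I -> sat j (sat j I) F -> sat j I F.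
Proof.
move=> idI [N HN].
have [M HM] : exists M, forall i, i \in enum 'I_d ->
    I ('X_(mxvec_index i j) ^+ M * ('X_(mxvec_index i j) ^+ N * F)).
  apply: seq_uniform_bound => [i M M' MM' H|i _]; first exact: is_ideal_expMr H.
  by have [M /(_ i)] := HN i; exists M.
by exists (M + N)%N => i; rewrite exprD -mulrA; apply: HM; rewrite mem_enum.
Qed.

(** The generic form is a nonzerodivisor modulo the saturation, because saturating twice adds
    nothing. *)
Lemma generic_form_sat_regular I j F : is_ideal I ->
  sat j (scalar_ext I) (generic_form tau d j * F) -> sat j (scalar_ext I) F.
Proof.
move=> idI [N HN]; apply: sat_idem; first exact: scalar_ext_ideal.
exists N => i; apply: generic_form_regular => //.
by rewrite mulrCA; apply: HN.
Qed.

End ExtensionDim.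

(** * The lower bound on Hilbert functions *)

Lemma sum_pred_deg n (u : 'I_n -> nat) j : (0 < u j)%N ->
  (\sum_k u k = (\sum_k pred_deg u j k).+1)%N.
Proof.
move=> uj; rewrite (bigD1 j) //= [in RHS](bigD1 j) //= /pred_deg eqxx.
rewrite -addSn subn1 prednK //.
by congr (_ + _)%N; apply: eq_bigr => k; rewrite eq_sym => /negPf ->; rewrite subn0.
Qed.

(** The field is generalized in the induction on [t], since each step passes from K to K(t). The
    Hilbert function of I is prescribed only beyond a threshold [B], since saturating or adjoining l
    controls it only in large degrees. *)
Lemma hilbert_lower_bound t (K : fieldType) d n (I J : {mpoly K[d * n]} -> Prop)
    D (u : 'I_n -> nat) B :
  (D + \sum_j u j < t)%N ->
  is_multihomog_ideal I -> is_ideal J -> (forall f g, J f -> J g -> I (f * g)) ->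
  (forall w : 'I_n -> nat, (forall j, B <= w j)%N ->
     quot_graded_dim I w 'C((\sum_j w j) + D, D)) ->
  has_indep J u 'C((\sum_j u j) + D, D).
Proof.
elim: t K I J D u B => // t IH K I J D u B; rewrite ltnS => Dut homI idJ JJ dimI.
have idI := homI.1.
have [/eqP u0|] := eqVneq (\sum_j u j)%N 0%N.
  rewrite (eqP u0) binn; exists (fun=> 1); split=> [_|v].
    move: u0; rewrite sum_nat_eq0 => /forallP u0.
    rewrite -mpolyX0; apply: is_homog_ofX => j; rewrite (eqP (u0 j)).
    by rewrite /coldeg big1 // => i _; rewrite mnm0E.
  rewrite lincomb1 => Jv; apply/rowP => k; rewrite ord1 mxE; apply: NNPP => /eqP nv.
  (* A nonzero [v] puts 1 in J, hence 1 = 1 * 1 in I; this contradicts the positive dimension in the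
     constant degree [B]. *)
  have I1 : I 1.
    rewrite -[1]mulr1; have := is_idealZ (v 0 0)^-1 idJ Jv.
    by rewrite scalerA mulVf // scale1r => J1; apply: JJ.
  have := dimI (fun=> B) (fun=> leqnn B).
  set N := 'C(_, _) => /quot_graded_dimP[b [_ ib _]].
  have : (0 < N)%N by rewrite bin_gt0 leq_addl.
  case: N b ib => // N b /(_ (const_mx 1)) H _.
  have /H/rowP/(_ 0)/eqP : I (lincomb b (const_mx 1)).
    by rewrite -[lincomb _ _]mulr1; apply: is_idealMr.
  by rewrite !mxE oner_eq0.
rewrite sum_nat_eq0 negb_forall => /existsP[j]; rewrite -lt0n => uj.
have [L [tau [tau_inj tau_frac]]] := rational_functions K.
have homI' := scalar_ext_homog tau_frac homI; have idI' := homI'.1.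
have idJ' := scalar_ext_ideal tau_frac idJ.
have JJ' := @scalar_ext_mul _ _ tau _ _ _ idI JJ.
set I' := scalar_ext tau I in homI' idI' JJ'; set J' := scalar_ext tau J in idJ' JJ'.
set l := generic_form tau d j.
have hl := @generic_form_homog _ _ tau d n j; rewrite -/l in hl.
have [B' HB'] := sat_eventually j idI'.
have dimI' w : (forall j, B <= w j)%N ->
    quot_graded_dim I' w 'C((\sum_j w j) + D, D).
  by move=> Bw; apply: scalar_ext_quot_graded_dim => //; apply: dimI.
apply: (has_indep_descent tau_frac) => //; rewrite -/J'.
have sumu := sum_pred_deg uj.
have indepA : has_indep (ideal_colon J' l) (pred_deg u j)
    'C((\sum_k pred_deg u j k) + D, D).
  apply: (IH _ (sat j I') _ _ _ (maxn B B')).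
  - by rewrite (leq_trans _ Dut) // sumu addnS.
  - exact: sat_homog.
  - exact: ideal_colon_ideal.
  (* Here l f and l g are in J', so l^2 f g is in I'; cancelling l twice lands in the saturation,
     hence [sat j I'] in place of [I']. *)
  - move=> f g Jf Jg; do 2 apply: generic_form_sat_regular => //.
    by apply: sub_sat => //; rewrite mulrA mulrACA; apply: JJ'.
  (* Where column j has degree at least [B'], the saturation agrees with I', so a basis for one
     serves for the other. *)
  - move=> w Bw; have Bw' i : (B <= w i)%N by apply: leq_trans (Bw i); rewrite leq_maxl.
    have /quot_graded_dimP[b [hb ib sb]] := dimI' w Bw'.
    apply/quot_graded_dimP; exists b; split=> //.
      move=> v Sv; apply: ib; apply: (HB' w) => //; first exact: lincomb_homog.
      by apply: leq_trans (Bw j); rewrite leq_maxr.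
    by move=> f /sb[v Iv]; exists v; apply: sub_sat.
(* For D = 0 the bound is 1 in every degree: the colon ideal supplies it and J' + l contributes the
   empty family. *)
case: D Dut dimI dimI' indepA => [|D] Dut dimI dimI' indepA.
  rewrite !bin0 in indepA *; rewrite -[1%N]addn0.
  apply: (has_indep_add idJ' hl uj indepA).
  by exists (fun=> 0); split=> [k|v _]; [exact: is_homog_of0|apply/rowP => -[]].
rewrite sumu addSn addnS binS -addnS.
apply: (has_indep_add idJ' hl uj indepA).
(* The threshold is raised by one so that w - e_j still lies beyond [B] and [B']. *)
rewrite -addSnnS -sumu; apply: (IH _ (adjoin I' l) _ _ _ (maxn B B').+1).
- exact: Dut.
- exact: adjoin_homog hl homI'.
- exact: adjoin_ideal.
- move=> _ _ [a [f [Ja ->]]] [b [g [Jb ->]]]; exists (a * b), (f * (b + l * g) + a * g).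
  split; first exact: JJ'.
  rewrite mulrDl [a * _]mulrDr -addrA; congr (_ + _).
  by rewrite [a * (l * g)]mulrCA -mulrA addrC -mulrDr.
move=> w Bw; have wj : (0 < w j)%N by apply: leq_trans (Bw j).
have Bw' k : (maxn B B' <= pred_deg w j k)%N.
  by have := Bw k; rewrite /pred_deg; case: eqP; lia.
(* Pascal's rule read as a difference, matching the cokernel dimension of multiplication by l. *)
have -> : 'C((\sum_k w k) + D, D) = ('C((\sum_k w k) + D.+1, D.+1) -
    'C((\sum_k pred_deg w j k) + D.+1, D.+1))%N.
  by rewrite (sum_pred_deg wj) [in RHS]addSn binS addKn addSnnS.
apply: (quot_graded_dim_adjoin homI' hl wj).
- move=> g hg Ig; apply: (HB' _ _ hg).
    by apply: leq_trans (Bw' j); rewrite leq_maxr.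
  exact: generic_form_regular Ig.
- by apply: dimI' => k; apply: leq_trans (ltnW (Bw k)); rewrite leq_maxl.
- by apply: dimI' => k; apply: leq_trans (Bw' k); rewrite leq_maxl.
Qed.

(** * Radicality *)

Section Radical.
Variables (K : fieldType) (d n : nat) (I : {mpoly K[d * n]} -> Prop).

Lemma Hdn_homog_sqr u f : (1 <= d)%N -> in_Hdn I -> is_homog_of u f ->
  I (f * f) -> I f.
Proof.
move=> d_gt0 [homI dimI] hf If2; have idI := homI.1.
have dimE w : ((\sum_j w j) + d - 1 = \sum_(j < n) w j + (d - 1))%N.
  by rewrite addnBA.
have [b [hb ib]] : has_indep (adjoin I f) u 'C((\sum_j u j) + (d - 1), d - 1).
  apply: (@hilbert_lower_bound _ _ _ _ I _ _ _ 0) (ltnSn _) homI _ _ _.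
  - exact: adjoin_ideal.
  - move=> _ _ [a [g [Ia ->]]] [a' [g' [Ia' ->]]].
    rewrite mulrDl; apply: (is_idealD idI); first exact: (is_idealMl idI).
    rewrite mulrDr; apply: (is_idealD idI) => //; first exact: (is_idealMr idI).
    by rewrite mulrACA; apply: (is_idealMl idI).
  - by move=> w _; rewrite -dimE; apply: dimI.
apply: NNPP => nIf.
(* If f were congruent modulo I to a combination of [b], that combination would lie in I + (f), so
   its coefficients vanish and f is in I. Hence f enlarges [b] beyond the dimension of
   (K[X]/I)_u. *)
have [c [hc ic]] : has_indep I u 'C((\sum_j u j) + (d - 1), d - 1).+1.
  apply: (indep_extend idI hb _ hf) => [v Iv|[v Iv]]; first exact/ib/sub_adjoin.
  case: nIf; suff v0 : v = 0 by move: Iv; rewrite v0 linear0 subr0.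
  apply: ib; exists (lincomb b v - f), 1; rewrite mulr1 subrK; split=> //.
  by rewrite -opprB; apply: (is_idealN idI).
have := dimI u; rewrite dimE => /quot_graded_dimP[e [_ _ se]].
by have := indep_spans_leq idI hc ic se; rewrite ltnn.
Qed.

(** The column degree packaged as a monomial in n variables, so that the monomial order gives a
    total order on degrees compatible with addition. *)
Definition coldeg_mnm (m : 'X_{1..d * n}) : 'X_{1..n} := [multinom coldeg m j | j < n].

Lemma coldeg_mnmD m1 m2 :
  coldeg_mnm (m1 + m2)%MM = (coldeg_mnm m1 + coldeg_mnm m2)%MM.
Proof. by apply/mnmP => j; rewrite mnmDE !mnmE coldegD. Qed.

Lemma max_coldeg_mnm (f : {mpoly K[d * n]}) : f != 0 ->
  exists2 m, m \in msupp f &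
    forall m', m' \in msupp f -> (coldeg_mnm m' <= coldeg_mnm m)%O.
Proof.
rewrite -msupp_eq0; elim: (msupp f) => // a s IH _.
have [->|/IH[m ms Hm]] := eqVneq s [::].
  by exists a => [|m']; rewrite inE // => /eqP ->.
have [am|ma] := leP (coldeg_mnm a) (coldeg_mnm m).
  exists m; first by rewrite inE ms orbT.
  by move=> m'; rewrite inE => /orP[/eqP ->|/Hm].
exists a; first by rewrite inE eqxx.
move=> m'; rewrite inE => /orP[/eqP ->|/Hm m'm] //.
exact: le_trans m'm (ltW ma).
Qed.

(** Induction on the number of terms: the component g of f of largest degree has its square in I, so
    g is in I by the homogeneous case; then (f - g)^2 is in I and f - g has fewer terms. *)
Lemma Hdn_sqr f : (1 <= d)%N -> in_Hdn I -> I (f * f) -> I f.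
Proof.
move=> d_gt0 HI; have [[idI hI] _] := HI.
have [N] := ubnP (size (msupp f)); elim: N f => // N IH f szf If2.
have [->|/max_coldeg_mnm[m mf Hm]] := eqVneq f 0; first exact: is_ideal0.
pose u := coldeg m; pose g := homog_comp u f.
have supp_g m' : m' \in msupp g -> m' \in msupp f.
  by rewrite !mcoeff_msupp mcoeff_homog_comp; case: ifP; rewrite ?eqxx.
have hg : is_homog_of u g := @homog_comp_is_homog _ _ _ u f.
have mcoeff_fg m' : (f - g)@_m' = if [forall j, coldeg m' j == u j] then 0 else f@_m'.
  by rewrite mcoeffB mcoeff_homog_comp; case: ifP; rewrite ?subrr ?subr0.
(* By maximality of u, the component of f^2 of degree 2u is g^2. *)
have gg : homog_comp (fun j => u j + u j)%N (f * f) = g * g.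
  have -> : f * f = g * g + (f - g) * (f + g).
    by rewrite -subr_sqr !expr2 addrC subrK.
  rewrite raddfD /= (homog_comp_id (is_homog_ofM hg hg)).
  rewrite homog_comp_eq0 ?addr0 // => _ /msuppM[a [b [afg bfg ->]]] e.
  have le_b : (coldeg_mnm b <= coldeg_mnm m)%O.
    by apply: Hm; have := msuppD_le bfg; rewrite mem_cat => /orP[//|/supp_g].
  have lt_a : (coldeg_mnm a < coldeg_mnm m)%O.
    move: afg; rewrite mcoeff_msupp mcoeff_fg; case: ifP => [|au]; first by rewrite eqxx.
    rewrite -mcoeff_msupp => /Hm; rewrite le_eqVlt => /orP[/eqP am|//].
    case/negP: au; apply/forallP => j.
    by move/mnmP: am => /(_ j); rewrite !mnmE => ->.
  have := ltmc_le_add lt_a le_b; rewrite -!coldeg_mnmD.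
  suff -> : coldeg_mnm (a + b) = coldeg_mnm (m + m) by rewrite ltxx.
  by apply/mnmP => j; rewrite !mnmE e coldegD.
have Ig : I g.
  by apply: (@Hdn_homog_sqr u) => //; rewrite -gg; apply: hI.
apply: (is_ideal_subr idI (g := g)) => //; apply: IH; last first.
  rewrite mulrBr; apply: (is_idealB idI) => //; last exact: (is_idealMr idI).
  by rewrite mulrBl; apply: (is_idealB idI) => //; apply: (is_idealMl idI).
rewrite -ltnS; apply: leq_trans szf; rewrite ltnS.
(* The monomial [m] has degree [u], so it is lost in passing from f to f - g. *)
have : {subset msupp (f - g) <= rem m (msupp f)}.
  move=> m'; rewrite mem_rem_uniq ?msupp_uniq // !inE !mcoeff_msupp mcoeff_fg.
  case: ifP => [|nu nf]; first by rewrite eqxx.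
  rewrite nf andbT; apply: contraFneq nu => ->.
  by apply/forallP => j.
move/(uniq_leq_size (msupp_uniq _)); rewrite size_rem //.
by case: (msupp f) mf.
Qed.

Lemma Hdn_radical : (1 <= d)%N -> in_Hdn I -> is_radical I.
Proof.
move=> d_gt0 HI f k Ifk; have [[idI _] _] := HI.
(* Raising the exponent to a power of two lets [Hdn_sqr] halve it repeatedly. *)
have : I (f ^+ (2 ^ k)).
  rewrite -(subnK (ltnW (ltn_expl k (ltnSn 1)))) exprD.
  exact: (is_idealMr idI).
elim: k {Ifk} => [|k IH]; first by rewrite expr1.
by rewrite expnS mul2n -addnn exprD => /(Hdn_sqr d_gt0 HI).
Qed.

End Radical.

Theorem theorem2p1 (K : fieldType) (d n : nat) (hd : (1 <= d)%N) (hn : (1 <= n)%N)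
    (I : {mpoly K[d * n]} -> Prop) :
  in_Hdn I -> is_radical I.
Proof. exact: Hdn_radical. Qed.
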